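(* Let $m\ne1$ be an odd positive integer with $\gcd(m,31)=1$ and no prime factor in $\mathcal{P}_0$. Let $\gamma=\gamma(m)=v_2(S(m))$ and let $Z(m)=2^{-\gamma}mS(m)$, a unit of $\mathbb{Z}_2$, so that $mS(m)=2^{\gamma}Z(m)$. Then: (i) if $0\le k<\gamma$, then $2^km\notin\mathcal{A}$ and $2^k\cdot31m\notin\mathcal{A}$; (ii) $2^{\gamma}m\in\mathcal{A}$ and $2^{\gamma}\cdot31m\in\mathcal{A}$; (iii) for $r\ge1$, setting $\mathcal{S}_r=\{2^r+1,2^r+3,\dots,2^{r+1}-1\}$, $$2^{\gamma+r}m\in\mathcal{A}\iff\exists\, l\in\mathcal{S}_r:\ m\equiv l^{-1}Z(m)\pmod{2^{r+1}},$$ $$2^{\gamma+r}\cdot31m\in\mathcal{A}\iff\exists\, l\in\mathcal{S}_r:\ m\equiv -(31l)^{-1}Z(m)\pmod{2^{r+1}}.$$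
   Context: Let $\mathcal{A}\subseteq\mathbb{N}$ be the unique set with $\prod_{a\in\mathcal{A}}(1-z^a)^{-1}=\sum_{n\ge0}p(\mathcal{A},n)z^n\equiv1+z+z^3+z^4+z^5\pmod 2$ coefficientwise ($p(\mathcal{A},n)$ = number of partitions of $n$ into parts from $\mathcal{A}$); $\chi(\mathcal{A},\cdot)$ is its characteristic function. For odd $m$, $S(m)=\sum_{k\ge0}\chi(\mathcal{A},2^km)2^k\in\mathbb{Z}_2$; under the hypotheses, $S(m)\neq0$. $v_2$ is the $2$-adic valuation. For $n$ not divisible by $31$, $\ell(n)\in\mathbb{Z}/6\mathbb{Z}$ is the unique $j$ with $n\equiv2^k3^j\pmod{31}$ for some $k\in\{0,\dots,4\}$; $\mathcal{P}_0$ is the set of odd primes $p\ne31$ with $\ell(p)=0$, i.e. $p\equiv1,2,4,8,16\pmod{31}$. Inverses are taken modulo $2^{r+1}$ (equivalently in $\mathbb{Z}_2$). *)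

(* Defs.v *)
From HB Require Import structures.
From mathcomp Require Import all_boot all_order all_algebra.
From mathcomp Require Import cyclic boolp.

Set Implicit Arguments.
Unset Strict Implicit.
Unset Printing Implicit Defensive.

Import GRing.Theory.

(* Z_2 as the inverse limit of the Z/2^n: [zres x n] is the representative of
   x modulo 2^n in {0, ..., 2^n - 1}. *)
Record Z2adic := MkZ2adic {
  zres : nat -> nat;
  zres_coh : forall n, zres n = zres n.+1 %% 2 ^ n
}.

Section Z2adicTheory.

Lemma Z2adic_ext (x y : Z2adic) : zres x =1 zres y -> x = y.
Proof.
case: x y => [f hf] [g hg] /= /funext fg.
by subst g; congr MkZ2adic; apply: Prop_irrelevance.
Qed.

Lemma zres_mod x n : zres x n %% 2 ^ n = zres x n.
Proof. by rewrite zres_coh modn_mod. Qed.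

Lemma zresS x n : zres x n.+1 = zres x n %[mod 2 ^ n].
Proof. by rewrite [in RHS]zres_coh modn_mod. Qed.

Lemma dvdn_exp2S n : 2 ^ n %| 2 ^ n.+1.
Proof. exact: dvdn_exp2l. Qed.

Lemma oflim_coh (f : nat -> nat) (hf : forall n, f n.+1 = f n %[mod 2 ^ n]) n :
  f n %% 2 ^ n = (f n.+1 %% 2 ^ n.+1) %% 2 ^ n.
Proof. by rewrite modn_dvdm ?dvdn_exp2S. Qed.

Definition oflim (f : nat -> nat) (hf : forall n, f n.+1 = f n %[mod 2 ^ n]) :=
  MkZ2adic (oflim_coh hf).

Lemma const_coh (a n : nat) : a = a %[mod 2 ^ n]. Proof. by []. Qed.
Definition zconst a := oflim (const_coh a).

Lemma add_coh x y n :
  zres x n.+1 + zres y n.+1 = zres x n + zres y n %[mod 2 ^ n].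
Proof. by rewrite -modnDm !zresS modnDm. Qed.
Definition zadd x y := oflim (add_coh x y).

Lemma mul_coh x y n :
  zres x n.+1 * zres y n.+1 = zres x n * zres y n %[mod 2 ^ n].
Proof. by rewrite -modnMm !zresS modnMm. Qed.
Definition zmul x y := oflim (mul_coh x y).

Lemma zres_le x n : zres x n <= 2 ^ n.
Proof. by rewrite -zres_mod ltnW // ltn_mod expn_gt0. Qed.

Lemma opp_coh x n :
  2 ^ n.+1 - zres x n.+1 = 2 ^ n - zres x n %[mod 2 ^ n].
Proof.
apply/eqP; rewrite -(eqn_modDr (zres x n)) subnK ?zres_le // modnn.
rewrite -modnDmr -zresS modnDmr subnK ?zres_le //.
by apply/eqP/eqP; exact: dvdn_exp2S.
Qed.
Definition zopp x := oflim (opp_coh x).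

Lemma zaddA : associative zadd.
Proof. by move=> x y z; apply: Z2adic_ext => n /=; rewrite modnDmr modnDml addnA. Qed.
Lemma zaddC : commutative zadd.
Proof. by move=> x y; apply: Z2adic_ext => n /=; rewrite addnC. Qed.
Lemma zadd0 : left_id (zconst 0) zadd.
Proof. by move=> x; apply: Z2adic_ext => n /=; rewrite mod0n add0n zres_mod. Qed.
Lemma zaddN : left_inverse (zconst 0) zopp zadd.
Proof.
by move=> x; apply: Z2adic_ext => n /=; rewrite modnDml subnK ?zres_le // modnn mod0n.
Qed.
Lemma zmulA : associative zmul.
Proof. by move=> x y z; apply: Z2adic_ext => n /=; rewrite modnMmr modnMml mulnA. Qed.
Lemma zmulC : commutative zmul.
Proof. by move=> x y; apply: Z2adic_ext => n /=; rewrite mulnC. Qed.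
Lemma zmul1 : left_id (zconst 1) zmul.
Proof. by move=> x; apply: Z2adic_ext => n /=; rewrite modnMml mul1n zres_mod. Qed.
Lemma zmulDl : left_distributive zmul zadd.
Proof.
by move=> x y z; apply: Z2adic_ext => n /=; rewrite modnMml modnDml modnDmr mulnDl.
Qed.

End Z2adicTheory.

HB.instance Definition _ := gen_eqMixin Z2adic.
HB.instance Definition _ := gen_choiceMixin Z2adic.
HB.instance Definition _ :=
  GRing.isZmodule.Build Z2adic zaddA zaddC zadd0 zaddN.

Lemma z1_neq0 : zconst 1 != 0%R :> Z2adic.
Proof. by apply/eqP => /(congr1 (fun x => zres x 1)). Qed.

HB.instance Definition _ := GRing.Zmodule_isComNzRing.Build Z2adic
  zmulA zmulC zmul1 zmulDl z1_neq0.

Section Z2adicUnit.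

Lemma odd_zres x n : 0 < n -> odd (zres x n) = odd (zres x 1).
Proof.
elim: n => // -[|n] IH _ //; rewrite -IH // [in RHS]zres_coh.
by rewrite odd_mod // oddX.
Qed.

Lemma expn_odd_mod2 a n : odd a -> a ^ 2 ^ n = 1 %[mod 2 ^ n].
Proof.
case: n => [|n] oa; first by rewrite !modn1.
have := @Euler_exp_totient a (2 ^ n.+1).
rewrite coprimeXr ?coprimen2 // => /(_ isT).
rewrite totient_pfactor //= mul1n => h.
have -> : a ^ 2 ^ n.+1 = (a ^ 2 ^ n) ^ 2 by rewrite -expnM mulnC -expnS.
by rewrite -modnXm h modnXm exp1n.
Qed.

(* Inverse of a unit: a^(2^n - 1) is an inverse of a modulo 2^n for odd a. *)
Lemma inv_coh x (hx : odd (zres x 1)) n :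
  zres x n.+1 ^ (2 ^ n.+1).-1 = zres x n ^ (2 ^ n).-1 %[mod 2 ^ n].
Proof.
have -> : (2 ^ n.+1).-1 = (2 ^ n).-1 + 2 ^ n.
  by rewrite expnS mul2n -addnn; case: (2 ^ n).
rewrite expnD -modnMmr expn_odd_mod2 ?odd_zres // modnMmr muln1.
by rewrite -modnXm zresS modnXm.
Qed.

Definition zunit : {pred Z2adic} := fun x => odd (zres x 1).

Definition zinv (x : Z2adic) : Z2adic :=
  if pselect (odd (zres x 1)) is left hx then oflim (inv_coh hx) else x.

Lemma zmulVx : {in zunit, left_inverse 1%R zinv *%R}.
Proof.
move=> x hx; rewrite /zinv; case: pselect => // h.
apply: Z2adic_ext => -[|n] /=; first by rewrite !modn1.
rewrite modnMml -expnSr prednK ?expn_gt0 // expn_odd_mod2 //.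
by rewrite odd_zres.
Qed.

Lemma zunitPl (x y : Z2adic) : (y * x = 1)%R -> zunit x.
Proof.
move=> /(congr1 (fun z => zres z 1)) /=; rewrite modn2 expn1 modn2 oddM /zunit.
by case: (odd (zres x 1)) => //; rewrite andbF.
Qed.

Lemma zinv_out : {in [predC zunit], zinv =1 id}.
Proof. by move=> x; rewrite inE /zinv => hx; case: pselect => // h; case/negP: hx. Qed.

End Z2adicUnit.

HB.instance Definition _ := GRing.ComNzRing_hasMulInverse.Build Z2adic
  zmulVx zunitPl zinv_out.

Definition z2eqmod (n : nat) (x y : Z2adic) : Prop :=
  exists t : Z2adic, (x = y + 2%:R ^+ n * t)%R.

(* The sum in Z_2 of the series of general term c k * 2^k. *)
Lemma series_coh (c : nat -> nat) n :
  \sum_(k < n.+1) c k * 2 ^ k = \sum_(k < n) c k * 2 ^ k %[mod 2 ^ n].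
Proof. by rewrite big_ord_recr /= -modnDmr modnMl addn0. Qed.
Definition z2series (c : nat -> nat) : Z2adic := oflim (series_coh c).

(* The valuation is the least n such that x is nonzero modulo 2^(n+1); it is
   given the conventional value 0 at x = 0. *)
Definition v2 (x : Z2adic) : nat :=
  if pselect (exists n, zres x n.+1 != 0) is left h then ex_minn h else 0.

(* 2^-k x when 2^k divides x in Z_2 (in general the k lowest binary digits of x
   are discarded). *)
Lemma divpow2_coh x k n :
  zres x (n.+1 + k) %/ 2 ^ k = zres x (n + k) %/ 2 ^ k %[mod 2 ^ n].
Proof.
rewrite [in RHS]zres_coh -addSn expnD.
by rewrite -modn_divl modn_mod.
Qed.
Definition divpow2 (k : nat) (x : Z2adic) : Z2adic := oflim (divpow2_coh x k).

Section Sanity.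

Lemma zres_nat a n : zres (a%:R : Z2adic)%R n = a %% 2 ^ n.
Proof.
elim: a => [|a IH]; first by [].
by rewrite mulrS /= IH modnDmr modnDml add1n.
Qed.

Lemma zresM (x y : Z2adic) n : zres (x * y)%R n = (zres x n * zres y n) %% 2 ^ n.
Proof. by []. Qed.

Lemma v2P (x : Z2adic) : x != 0%R ->
  (x = 2%:R ^+ v2 x * divpow2 (v2 x) x)%R /\ divpow2 (v2 x) x \is a GRing.unit.
Proof.
move=> x0; have ex : exists n, zres x n.+1 != 0.
  apply: contrapT => nex; case/eqP: x0; apply: Z2adic_ext => -[|n] /=.
    by rewrite -zres_mod !modn1.
  rewrite mod0n; apply: contrapT => /eqP h; by apply: nex; exists n.
rewrite /v2; case: pselect => // h; case: ex_minnP => v hv vmin {ex h}.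
have zv : zres x v = 0.
  case: v hv vmin => [|v] _ vmin; first by rewrite -zres_mod modn1.
  by apply/eqP/negPn/negP => /vmin; rewrite ltnn.
have dv n : 2 ^ v %| zres x (n + v).
  elim: n => [|n]; first by rewrite add0n zv.
  by rewrite [zres x (n + v)]zres_coh addSn /dvdn modn_dvdm // dvdn_exp2l // leq_addl.
split; last first.
  change (odd (zres x (1 + v) %/ 2 ^ v %% 2 ^ 1)).
  have := zres_mod x (1 + v); rewrite add1n expnS => hlt.
  have := dv 1; rewrite add1n => d.
  have qlt : zres x v.+1 %/ 2 ^ v < 2.
    by rewrite ltn_divLR ?expn_gt0 // -hlt ltn_mod muln_gt0 expn_gt0.
  have : zres x v.+1 %/ 2 ^ v != 0.
    by apply: contraNneq hv => q0; rewrite -(divnK d) q0 mul0n.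
  by rewrite expn1; case: (_ %/ _) qlt => [|[|]].
apply: Z2adic_ext => n; rewrite -natrX zresM zres_nat.
rewrite /= modnMml modnMmr mulnC divnK //.
have mono k : zres x (n + k) %% 2 ^ n = zres x n.
  elim: k => [|k IH]; first by rewrite addn0 zres_mod.
  rewrite -IH [zres x (n + k)]zres_coh addnS modn_dvdm // dvdn_exp2l // leq_addr //.
by rewrite mono.
Qed.

End Sanity.

(* p(A, n): a partition of n into parts from A is encoded by the multiplicities
   f i of the parts i + 1, for i < n. *)
Definition npart (A : {pred nat}) (n : nat) : nat :=
  #|[set f : {ffun 'I_n -> 'I_n.+1} |
      [forall i, (f i != 0 :> nat) ==> (i.+1 \in A)]
      && (\sum_i f i * i.+1 == n)]|.

(* A is a set of positive integers with sum_n p(A, n) z^n = P(z) modulo 2. *)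
Definition npart_congr (A : {pred nat}) (P : {poly 'F_2}) : Prop :=
  0 \notin A /\ forall n, ((npart A n)%:R = P`_n :> 'F_2)%R.

Definition P31 : {poly 'F_2} := (1 + 'X + 'X^3 + 'X^4 + 'X^5)%R.

Definition chi (A : {pred nat}) (n : nat) : nat := n \in A.

Definition S2 (A : {pred nat}) (m : nat) : Z2adic :=
  z2series (fun k => chi A (2 ^ k * m)).

(* The conventional value for n divisible by 31 is 0. *)
Definition ell (n : nat) : 'Z_6 :=
  odflt 0%R
    [pick j : 'Z_6 | [exists k : 'I_5, n == 2 ^ k * 3 ^ j %[mod 31]]].

Definition P0 (p : nat) : bool :=
  [&& prime p, odd p, p != 31 & ell p == 0%R].

Definition gamma (A : {pred nat}) (m : nat) : nat := v2 (S2 A m).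

(* For odd m, m S(m) has the same valuation as S(m), so that the division is
   exact and the quotient is a unit as soon as S(m) <> 0. *)
Definition Zunit (A : {pred nat}) (m : nat) : Z2adic :=
  divpow2 (gamma A m) (m%:R * S2 A m)%R.

(* {2^r + 1, 2^r + 3, ..., 2^(r+1) - 1} for r >= 1 *)
Definition Sr (r : nat) : {pred nat} :=
  [pred l | odd l && (2 ^ r < l < 2 ^ r.+1)].

(* Main.v *)
(* Write sigma(n) for the sum of the divisors of n lying in A. Let x be an
   algebraic integer with x^5 + x^4 + x^2 + x + 1 = 0. Modulo 2, the series of
   general term p(A, n) z^n is the product of the 1 - x^(2^i) z for i < 5, and
   comparing logarithmic derivatives gives
     sigma(2^k m) = - sum_(i < 5) b^(2^i m)  modulo 2^(k+1),  b = x^(2^k),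
   where b^31 = 1 modulo 2^(k+1). For odd m the left-hand side tends to the sum
   of d S(d) over the divisors d of m. Hence 31 m S(31 m) = - m S(m) for m > 1.
   By Moebius inversion m S(m) is a Z-linear combination of powers of b, which
   the character n |-> n^5 of (Z/31)^*, of kernel {1, 2, 4, 8, 16}, maps to a
   product of factors p^5 - 1 over the primes p dividing m, up to a unit. No
   factor vanishes, so the combination is nontrivial, and S(m) <> 0 since the
   31st cyclotomic polynomial is irreducible. The theorem then reads the binary
   digits of S(m) and S(31 m). *)
From HB Require Import structures.
Require Import Defs.
From mathcomp Require Import all_boot all_order all_algebra all_field.
From mathcomp Require Import ring zify.

Set Implicit Arguments.
Unset Strict Implicit.
Unset Printing Implicit Defensive.

Import GRing.Theory Num.Theory.
Local Open Scope ring_scope.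

(** * Sums over divisors *)

(** A divisor of [p ^ e * m] is [p ^ i * d] for a unique divisor [d] of [m]; the exponent [i] is
    recovered as its valuation at [p]. *)
Lemma sum_divisors_pfactor (V : nmodType) (F : nat -> V) p e m :
  prime p -> coprime p m -> (0 < m)%N ->
  \sum_(d <- divisors (p ^ e * m)) F d =
  \sum_(i < e.+1) \sum_(d <- divisors m) F (p ^ i * d)%N.
Proof.
move=> p_pr co_pm m_gt0; have p_gt0 := prime_gt0 p_pr.
have p_n i d : d \in divisors m -> logn p (p ^ i * d) = i.
  rewrite -dvdn_divisors // => dm; have d_gt0 := dvdn_gt0 m_gt0 dm.
  by rewrite lognM ?expn_gt0 ?p_gt0 // pfactorK //
    (logn_coprime (coprime_dvdr dm co_pm)) addn0.
have [s [s_uniq mem_s sum_s]] : exists s,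
  [/\ uniq s, forall i, (i \in s) = (i <= e)%N
    & forall G : nat -> V, \sum_(i <- s) G i = \sum_(i < e.+1) G i].
  exists (index_iota 0 e.+1); split=> [|i|G]; first exact: iota_uniq.
    by rewrite mem_index_iota ltnS.
  by rewrite big_mkord.
transitivity (\sum_(d <- [seq (p ^ i * d)%N | i <- s, d <- divisors m]) F d).
  apply: perm_big; apply: uniq_perm; first exact: divisors_uniq.
    apply: allpairs_uniq; [by [] | exact: divisors_uniq |].
    move=> [i d] [j c] h1 h2 /= E.
    have /allpairsP[[i' d'] [/= _ dm [? ?]]] := h1; subst i d.
    have /allpairsP[[j' c'] [/= _ cm [? ?]]] := h2; subst j c.
    have ij : i' = j' by rewrite -(p_n i' d' dm) -(p_n j' c' cm) E.
    rewrite ij; congr (_, _); apply/eqP;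
      rewrite -(@eqn_pmul2l (p ^ j')) ?expn_gt0 ?p_gt0 //.
    by rewrite -E ij.
  move=> d; rewrite -dvdn_divisors ?muln_gt0 ?expn_gt0 ?p_gt0 //;
    apply/idP/allpairsP.
    move=> dm; have d_gt0 : (0 < d)%N by apply: dvdn_gt0 dm;
      rewrite muln_gt0 expn_gt0 p_gt0.
    have [c co_pc dE] := pfactor_coprime p_pr d_gt0.
    exists (logn p d, c); split => /=; last by rewrite mulnC.
      rewrite mem_s.
      have := dvdn_leq_log p _ dm;
        rewrite lognM ?expn_gt0 ?p_gt0 // pfactorK //.
      rewrite (logn_coprime co_pm) addn0; apply.
      by rewrite muln_gt0 expn_gt0 p_gt0.
    rewrite -dvdn_divisors //;
      have: (c %| p ^ e * m)%N by apply: dvdn_trans dm; rewrite dE dvdn_mulr.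
    by rewrite Gauss_dvdr // coprimeXr // coprime_sym.
  case=> [[i c]] /= []; rewrite mem_s => ie.
  rewrite -dvdn_divisors // => cm ->.
  by apply: dvdn_mul => //; apply: dvdn_exp2l.
by rewrite big_allpairs_dep sum_s.
Qed.

(** * Divisibility in a commutative ring and inversion of divisor sums *)

Definition dvdr (R : comNzRingType) (t x : R) := exists y, x = t * y.

Section Dvdr.
Variable (R : comNzRingType) (t : R).
Lemma dvdr0 : dvdr t 0. Proof. by exists 0; rewrite mulr0. Qed.
Lemma dvdrD x y : dvdr t x -> dvdr t y -> dvdr t (x + y).
Proof. by case=> a -> [b ->]; exists (a + b); rewrite mulrDr. Qed.
Lemma dvdrN x : dvdr t x -> dvdr t (- x).
Proof. by case=> a ->; exists (- a); rewrite mulrN. Qed.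
Lemma dvdrB x y : dvdr t x -> dvdr t y -> dvdr t (x - y).
Proof. by move=> dx /dvdrN; apply: dvdrD. Qed.
Lemma dvdrM x y : dvdr t y -> dvdr t (x * y).
Proof. by case=> a ->; exists (x * a); rewrite mulrCA. Qed.
Lemma dvdr_sum (I : Type) (r : seq I) (P : pred I) (F : I -> R) :
  (forall i, P i -> dvdr t (F i)) -> dvdr t (\sum_(i <- r | P i) F i).
Proof. by move=> h; apply: big_ind => //; [apply: dvdr0 | apply: dvdrD]. Qed.
End Dvdr.

(** Moebius inversion without the Moebius function: [f m] is the divisor sum at [m] minus the values
    at proper divisors, which the induction covers. With [t = 0] this is uniqueness of the inverse;
    with [t] a power of 2 it is a congruence. *)
Lemma divisor_sum_inj (R : comNzRingType) (t : R) (f : nat -> R) m :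
  (0 < m)%N ->
  (forall n, (n %| m)%N -> dvdr t (\sum_(d <- divisors n) f d)) -> dvdr t (f m).
Proof.
elim/ltn_ind: m => m IH m_gt0 H.
have := H m (dvdnn m);
  rewrite (bigD1_seq m) ?divisors_id ?divisors_uniq //= => Hm.
rewrite -[f m](addrK (\sum_(i <- divisors m | i != m) f i)).
apply: dvdrB => //; rewrite big_seq_cond; apply: dvdr_sum => d /andP[].
rewrite -dvdn_divisors // => dm dNm.
apply: IH => [||n nd]; last by apply: H; apply: dvdn_trans dm.
  by rewrite ltn_neqAle dNm dvdn_leq.
exact: dvdn_gt0 dm.
Qed.

(** Existence of the Moebius inverse: raising the bound only requires a new value of [f] at [N.+1],
    which divides no smaller positive [m]. *)
Lemma divisor_sum_surj (V : zmodType) (h : nat -> V) N :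
  exists f : nat -> V, forall m, (0 < m <= N)%N ->
    \sum_(d <- divisors m) f d = h m.
Proof.
elim: N => [|N [f Hf]]; first by exists (fun=> 0) => -[].
exists (fun d => if d == N.+1
   then h N.+1 - \sum_(d <- divisors N.+1 | d != N.+1) f d else f d) => m.
case/andP=> m_gt0; rewrite leq_eqVlt => /orP[/eqP->|].
  rewrite (bigD1_seq N.+1) ?divisors_id ?divisors_uniq //= eqxx.
  rewrite [X in _ + X](eq_bigr f) ?subrK // => i /negbTE ->//.
rewrite ltnS => mN; rewrite -(Hf m) ?m_gt0 //; apply: eq_big_seq => d.
rewrite -dvdn_divisors // => /(dvdn_leq m_gt0) dm.
by rewrite ltn_eqF // ltnS (leq_trans dm).
Qed.

(* The Dirichlet convolution of the Moebius function and of the completely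
   multiplicative function given by psi on the primes, evaluated at m <= N. *)
Lemma divisor_sum_mult (R : comNzRingType) (psi : nat -> R) m N :
  (0 < m <= N)%N ->
  \sum_(d <- divisors m) \prod_(p < N.+1 | prime p)
     (if logn p d is e.+1 then psi p ^+ e.+1 - psi p ^+ e else 1) =
  \prod_(p < N.+1 | prime p) psi p ^+ logn p m.
Proof.
elim/ltn_ind: m => m IH /andP[m_gt0 mN].
have [->|m_neq1] := eqVneq m 1%N.
  rewrite big_seq1 !big1 // => i _; by rewrite logn1.
set p := pdiv m;
  have p_pr : prime p by rewrite pdiv_prime // ltn_neqAle eq_sym m_neq1.
have [n co_pn mE] := pfactor_coprime p_pr m_gt0.
have n_gt0 : (0 < n)%N by move: m_gt0; rewrite mE muln_gt0 => /andP[].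
have e_gt0 : (0 < logn p m)%N
  by rewrite logn_gt0 mem_primes p_pr m_gt0 pdiv_dvd.
move: mE; set e := logn p m => mE.
have pN : (p < N.+1)%N by rewrite ltnS (leq_trans _ mN) // dvdn_leq // pdiv_dvd.
have n_lt : (n < m)%N
  by rewrite mE -[X in (X < _)%N]muln1 ltn_pmul2l // -(exp1n e) ltn_exp2r //
    prime_gt1.
rewrite mE mulnC sum_divisors_pfactor //.
pose loc q c : R := if logn q c is e.+1 then psi q ^+ e.+1 - psi q ^+ e else 1.
have lognq i d q : (d \in divisors n) -> prime q -> q != p ->
    logn q (p ^ i * d) = logn q d.
  rewrite -dvdn_divisors // => dn q_pr qp; have d_gt0 := dvdn_gt0 n_gt0 dn.
  by rewrite lognM ?expn_gt0 ?(prime_gt0 p_pr) // lognX logn_prime //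
    (negbTE qp) muln0.
have lognp i d : (d \in divisors n) -> logn p (p ^ i * d) = i.
  rewrite -dvdn_divisors // => dn; have d_gt0 := dvdn_gt0 n_gt0 dn.
  by rewrite lognM ?expn_gt0 ?(prime_gt0 p_pr) // pfactorK //
    (logn_coprime (coprime_dvdr dn co_pn)) addn0.
have split (F : nat -> R) : \prod_(q < N.+1 | prime q) F q = F p *
  \prod_(q < N.+1 | prime q && (q != p :> nat)) F q :> R.
  by rewrite (bigD1 (Ordinal pN)).
have nD : n \in divisors n by rewrite divisors_id.
rewrite (split (fun q => psi q ^+ logn q (p ^ e * n))) lognp //.
rewrite [X in _ = _ * X](eq_bigr (fun q : 'I__ => psi q ^+ logn q n));
  last by move=> q /andP[? ?]; rewrite lognq.
have -> : \prod_(q < N.+1 | prime q && (q != p :> nat)) psi q ^+ logn q n =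
   \prod_(q < N.+1 | prime q) psi q ^+ logn q n.
  by rewrite (split (fun q => psi q ^+ logn q n)) (logn_coprime co_pn) mul1r.
rewrite -IH ?n_gt0 //; last by rewrite (leq_trans (ltnW n_lt)).
pose G d := \prod_(q < N.+1 | prime q) loc q d.
rewrite (eq_bigr
  (fun i : 'I_e.+1 =>
    (if i : nat is j.+1 then psi p ^+ j.+1 - psi p ^+ j else 1) *
   \sum_(d <- divisors n) G d)); last first.
  move=> i _; rewrite big_distrr /=; apply: eq_big_seq => d dn.
  rewrite (split (fun q => loc q (p ^ i * d)%N)) /loc lognp //; congr (_ * _).
  rewrite /G (split (fun q => loc q d)) /loc (logn_coprime (_ : coprime p d));
    last first.
    by apply: coprime_dvdr co_pn; rewrite dvdn_divisors.
  by rewrite mul1r; apply: eq_bigr => q /andP[? ?]; rewrite lognq.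
rewrite -big_distrl /=; congr (_ * _).
(* The local factor at [p] is 1 plus successive differences of powers of [psi p]; it telescopes to
   [psi p ^+ e]. *)
rewrite big_ord_recl /=
  -(big_mkord xpredT (fun i => psi p ^+ i.+1 - psi p ^+ i)).
by rewrite telescope_sumr // expr0 addrC subrK.
Qed.

(** * Logarithmic derivatives of truncated series *)

(* w is - X u'/u up to order N. *)
Definition logd (R : comNzRingType) N (u w : {poly R}) :=
  dvdr 'X^(N.+1) ('X * u^`() + u * w).

Section LogDerivative.
Variables (R : comNzRingType) (N : nat).
Implicit Types (u w : {poly R}) (b : R).

Lemma dvdr_polyXn_coef u n : dvdr 'X^(N.+1) u -> (n <= N)%N -> u`_n = 0.
Proof. by case=> v -> nN; rewrite coefXnM ltnS nN. Qed.

Lemma logdM u1 w1 u2 w2 :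
  logd N u1 w1 -> logd N u2 w2 -> logd N (u1 * u2) (w1 + w2).
Proof.
move=> [v1 h1] [v2 h2]; exists (v1 * u2 + v2 * u1).
rewrite derivM [RHS]mulrDr !mulrA -h1 -h2; ring.
Qed.

Lemma logd_prod (I : finType) (P : pred I) (u w : I -> {poly R}) :
  (forall i, P i -> logd N (u i) (w i)) ->
  logd N (\prod_(i | P i) u i) (\sum_(i | P i) w i).
Proof.
move=> h; apply: (big_ind2 (logd N)) => // [|u1 w1 u2 w2]; last exact: logdM.
by rewrite /logd derivC !mulr0 addr0; apply: dvdr0.
Qed.

(** The expansion of - X u'/u for u = 1 - b X^a: [a] times the geometric series of b X^a without its
    constant term, cut after N + 1 terms. *)
Definition logd_term b a : {poly R} :=
  \sum_(j < N.+1) (b%:P * 'X^a) ^+ j.+1 *+ a.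

Lemma logd_factor b a : (0 < a)%N -> logd N (1 - b%:P * 'X^a) (logd_term b a).
Proof.
case: a => // a _; rewrite /logd; set y := b%:P * _.
have -> : 'X * (1 - y)^`() = - (y *+ a.+1).
  rewrite derivB derivC sub0r mulrN; congr (- _).
  by rewrite /y derivM derivC mul0r add0r derivXn /= !mulrnAr mulrCA -exprS.
have -> : logd_term b a.+1 = (y * \sum_(j < N.+1) y ^+ j) *+ a.+1.
  by rewrite /logd_term big_distrr /= -sumrMnl; apply: eq_bigr => j _;
    rewrite exprS.
have -> : - (y *+ a.+1) + (1 - y) * ((y * \sum_(j < N.+1) y ^+ j) *+ a.+1)
   = - (y ^+ N.+2) *+ a.+1.
  rewrite mulrnAr -mulNrn -mulrnDl; congr (_ *+ _).
  have := subrX1 y N.+1; rewrite (exprS y N.+1).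
  set s := \sum_(_ < _) _ => E;
    have -> : y ^+ N.+1 = (y - 1) * s + 1 by rewrite -E subrK.
  ring.
exists (- (b ^+ N.+2)%:P * 'X^(a + a * N.+1 + 1) *+ a.+1).
rewrite /y exprMn -rmorphXn /= -exprM.
have -> : (a.+1 * N.+2 = N.+1 + (a + a * N.+1 + 1))%N by lia.
by rewrite exprD; ring.
Qed.

Lemma coef_logd_term b a n : (0 < n <= N)%N -> (0 < a)%N ->
  (logd_term b a)`_n = if (a %| n)%N then b ^+ (n %/ a) *+ a else 0.
Proof.
move=> /andP[n_gt0 nN] a_gt0; rewrite coef_sum.
have E (j : 'I_N.+1) : ((b%:P * 'X^a) ^+ j.+1 *+ a)`_n =
    if n == (a * j.+1)%N then b ^+ j.+1 *+ a else 0.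
  rewrite coefMn exprMn -rmorphXn /= -exprM coefCM coefXn.
  by case: eqP => _; rewrite ?mulr1 // mulr0 mul0rn.
rewrite (eq_bigr _ (fun j _ => E j)) -big_mkcond /=.
case: ifP => [/dvdnP[c nE]|ndiv]; last first.
  by rewrite big1 // => j /eqP nE; rewrite nE dvdn_mulr in ndiv.
case: c nE => [|c] nE; first by rewrite nE in n_gt0.
have cN : (c < N.+1)%N by rewrite ltnS (leq_trans _ nN) // nE; nia.
rewrite (big_pred1 (Ordinal cN)); first by rewrite /= nE mulnK.
move=> j /=; rewrite -val_eqE /= nE mulnC eqn_pmul2l // eqSS.
by rewrite eq_sym.
Qed.

(** The square of 1 + 2^(k+1) B is 1 + 2^(k+2) (B + 2^k B^2): each squaring gains one factor 2. *)
Lemma expr2k_cong u k (H : {poly R}) :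
  dvdr 'X^(N.+1) (u - 1 - H *+ 2) ->
  exists B, dvdr 'X^(N.+1) (u ^+ (2 ^ k) - 1 - B *+ (2 ^ k.+1)).
Proof.
move=> hu; elim: k => [|k [B [V E]]]; first by exists H.
exists (B + B ^+ 2 *+ 2 ^ k); exists (V * (u ^+ (2 ^ k) + 1 + B *+ 2 ^ k.+1)).
rewrite [X in u ^+ X]expnS mulnC exprM mulrA -E (expnS 2 k.+1) (expnS 2 k).
move: (u ^+ (2 ^ k)) => U; move: (2 ^ k)%N => c; ring.
Qed.

(* X (u^(2^k))' = - 2^k u^(2^k) w, while u^(2^k) is 1 modulo 2^(k+1): in degree
   n, the left-hand side is divisible by n 2^(k+1). *)
Lemma logd_cong u w k n (H : {poly R}) :
  (forall x : R, x *+ 2 = 0 -> x = 0) ->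
  logd N u w -> dvdr 'X^(N.+1) (u - 1 - H *+ 2) ->
  (n <= N)%N -> (2 ^ k %| n)%N -> dvdr (2 ^ k.+1)%:R w`_n.
Proof.
move=> two_torsion_free [v uw] /(expr2k_cong k)[B [V uB]] nN /dvdnP[m nE].
have tfk x : x *+ 2 ^ k = 0 -> x = 0 :> R.
  elim: k {uB nE} x => [|k IH] x; first by [].
  by rewrite expnS mulrnA => /IH/two_torsion_free.
move: uB nE tfk; rewrite (expnS 2 k); have: (0 < 2 ^ k)%N by rewrite expn_gt0.
case: (2 ^ k)%N => // c _.
have [c' c'E] : exists c', c' = c.+1 by exists c.+1.
rewrite -c'E => uB nE tfk.
have uE : u ^+ c' = 1 + B *+ (2 * c') + 'X^(N.+1) * V by rewrite -uB; ring.
move: uw uE uB; set T := 'X^(N.+1); set U := u ^+ c' => uw uE _.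
have XT : 'X * T^`() = T *+ N.+1 by rewrite derivXn /= mulrnAr -exprS.
have d1 : 'X * U^`() = 'X * B^`() *+ (2 * c') + T *+ N.+1 * V + 'X * T * V^`().
  by rewrite uE !derivD derivC derivMn derivM add0r -XT; ring.
have d2 : 'X * U^`() = ((T * v) * u ^+ c - U * w) *+ c'.
  rewrite -uw /U deriv_exp c'E exprS /= -c'E; move: (u ^+ c) => Uc; ring.
(* X U' has been computed in two ways, from the expansion of [U] and from the logarithmic
   derivative. In degree n = m c', the derivative of [B] contributes m c' B_n, so that [c'] can be
   factored out of the whole identity and cancelled by [tfk]. *)
have hZ : 'X * B^`() *+ (2 * c') + (w + B * w *+ (2 * c')) *+ c' =
    T * (v * u ^+ c *+ c' - V *+ N.+1 - 'X * V^`() - V * w *+ c').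
  move: d2; rewrite d1 uE => d2; apply/eqP; rewrite -subr_eq0; apply/eqP.
  move/eqP: d2; rewrite -subr_eq0 => /eqP d2; rewrite -[RHS]d2;
    move: (u ^+ c) => Uc; ring.
have := congr1 (fun p : {poly R} => p`_n) hZ.
rewrite coefXnM ltnS nN coefD !coefMn coefD coefMn coefXM => E.
exists (- (B`_n *+ m) - (B * w)`_n).
suff: w`_n + (B * w)`_n *+ (2 * c') + B`_n *+ m *+ (2 * c') = 0.
  by move=> E1; rewrite -[RHS]add0r -[X in X + _]E1; ring.
apply: tfk; rewrite -[RHS]E coef_deriv nE.
case: eqP => [|]; last first.
  move=> /eqP; rewrite -lt0n => n_gt0; rewrite prednK //; ring.
move/eqP; rewrite muln_eq0 c'E orbF => /eqP ->; ring.
Qed.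
End LogDerivative.

(** * The generating series of partitions *)

Lemma dvdr_prod_cong (R : comNzRingType) (t : R) (I : Type) (r : seq I)
    (P : pred I) (F G : I -> R) :
  (forall i, P i -> dvdr t (F i - G i)) ->
  dvdr t (\prod_(i <- r | P i) F i - \prod_(i <- r | P i) G i).
Proof.
move=> h; apply: (big_ind2 (fun x y => dvdr t (x - y))) => //.
  by rewrite subrr; apply: dvdr0.
move=> x1 x2 y1 y2 hx hy.
have -> : x1 * y1 - x2 * y2 = y1 * (x1 - x2) + x2 * (y1 - y2) by ring.
by apply: dvdrD; apply: dvdrM.
Qed.

Section PartitionSeries.
Variables (R : comNzRingType) (A : {pred nat}).

(** Parts and multiplicities are both bounded by [N], so that expanding the product for [N = n]
    yields exactly the functions counted by [npart A n]. *)
Definition part_series N : {poly R} :=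
  \prod_(i < N) if i.+1 \in A then \sum_(f < N.+1) 'X^(f * i.+1) else 1.

Lemma coef_part_series_diag n : (part_series n)`_n = (npart A n)%:R.
Proof.
rewrite /part_series.
(* The factor 1 of a part outside [A] is written as a sum in which only multiplicity 0 survives; all
   factors then have one shape and the product distributes over functions. *)
rewrite (eq_bigr (fun i : 'I_n => \sum_(f < n.+1)
    if (f != 0 :> nat) ==> (i.+1 \in A) then 'X^(f * i.+1) else 0)); last first.
  move=> i _; case: ifP => _; first by apply: eq_bigr => f _; rewrite implybT.
  rewrite (bigD1 ord0) //= mul0n expr0 big1 ?addr0 // => f.
  by rewrite -val_eqE /= => /negbTE ->.
rewrite bigA_distr_bigA coef_sum /npart -sum1dep_card natr_sum
  [RHS]big_mkcond /=.
apply: eq_bigr => f _.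
case: (boolP [forall i, (f i != 0 :> nat) ==> (i.+1 \in A)]) => [/forallP fA|].
  rewrite (eq_bigr (fun i => 'X^(f i * i.+1))) => [|i _]; last by rewrite fA.
  rewrite prodrXr coefXn /= eq_sym; by case: eqP.
rewrite negb_forall => /existsP[i /negbTE fi] /=.
by rewrite (bigD1 i) //= fi mul0r coef0.
Qed.

(** The new part [N.+1], and the new multiplicity [N.+1] of an old part, only bring in monomials of
    degree at least [N.+1]. *)
Lemma part_seriesS N : dvdr 'X^(N.+1) (part_series N.+1 - part_series N).
Proof.
rewrite /part_series big_ord_recr /=.
set c := (if _ then _ else _).
have hc : dvdr 'X^(N.+1) (c - 1).
  rewrite /c; case: ifP => _; last by rewrite subrr; apply: dvdr0.
  rewrite big_ord_recl /= mul0n expr0 addrC addrA addNr add0r.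
  by apply: dvdr_sum => f _; exists 'X^(f * N.+1); rewrite -exprD -mulSn.
set p := \prod_(i < N) _; set q := \prod_(i < N) _.
have hpq : dvdr 'X^(N.+1) (p - q).
  apply: dvdr_prod_cong => i _; case: ifP => _; last by rewrite subrr;
    apply: dvdr0.
  rewrite big_ord_recr /= addrAC subrr add0r.
  by exists 'X^(N.+1 * i); rewrite -exprD -mulnS.
have -> : p * c - q = p * (c - 1) + (p - q) by ring.
by apply: dvdrD => //; apply: dvdrM.
Qed.

Lemma coef_part_series N n : (n <= N)%N -> (part_series N)`_n = (npart A n)%:R.
Proof.
elim: N => [|N IH]; first by rewrite leqn0 => /eqP ->;
  apply: coef_part_series_diag.
rewrite leq_eqVlt => /orP[/eqP ->|]; first exact: coef_part_series_diag.
rewrite ltnS => nN; rewrite -IH //.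
have := dvdr_polyXn_coef (part_seriesS N) nN.
by rewrite coefB => /eqP; rewrite subr_eq0 => /eqP.
Qed.

Definition part_euler N : {poly R} :=
  \prod_(i < N | i.+1 \in A) (1 - 1%:P * 'X^(i.+1)).

(** Factor by factor, 1 - y times the truncated geometric series is 1 - y^(N+1), where y is a
    monomial of positive degree. *)
Lemma part_eulerK N : dvdr 'X^(N.+1) (part_euler N * part_series N - 1).
Proof.
rewrite /part_euler big_mkcond /= -big_split /=.
have p1 : 1 = \prod_(i < N) 1 :> {poly R} by rewrite big1.
rewrite [X in _ - X]p1.
apply: dvdr_prod_cong => i _; case: ifP => _; last by rewrite mulr1 subrr;
  apply: dvdr0.
set y : {poly R} := 'X^(i.+1).
have -> : \sum_(f < N.+1) 'X^(f * i.+1) = \sum_(f < N.+1) y ^+ f.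
  by apply: eq_bigr => f _; rewrite /y -exprM mulnC.
have := subrX1 y N.+1; set s := \sum_(_ < _) _ => E.
have -> : (1 - 1%:P * y) * s - 1 = - y ^+ N.+1.
  by rewrite mul1r -[y ^+ N.+1](subrK 1) E; ring.
by apply: dvdrN; exists 'X^(i * N.+1); rewrite -exprD -exprM -mulSn.
Qed.

End PartitionSeries.

Definition P31c (n : nat) : nat := n \in [:: 0; 1; 3; 4; 5]%N.

Definition P31R (R : comNzRingType) : {poly R} := 1 + 'X + 'X^3 + 'X^4 + 'X^5.

Lemma coef_P31R (R : comNzRingType) n : (P31R R)`_n = (P31c n)%:R.
Proof.
rewrite /P31R !coefD coef1 coefX !coefXn /P31c !inE.
by case: n => [|[|[|[|[|[|n]]]]]]; rewrite /= ?addr0 ?add0r.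
Qed.

Lemma npart_odd A n : npart_congr A P31 -> odd (npart A n) = odd (P31c n).
Proof.
case=> _ /(_ n); rewrite (coef_P31R 'F_2) => /(congr1 val).
by rewrite /= !val_Fp_nat // !modn2; do 2 case: odd.
Qed.

(** Modulo 2 and up to order [N], [Q] is the partition series, whose inverse is the Euler
    product. *)
Lemma part_euler_P31 (R : comNzRingType) A N (Q : {poly R}) G :
  npart_congr A P31 -> Q = P31R R + G *+ 2 ->
  exists H, dvdr 'X^(N.+1) (part_euler R A N * Q - 1 - H *+ 2).
Proof.
move=> hA ->; set D := part_euler R A N; set E := part_series R A N.
have [V hV] := part_eulerK R A N.
(* [npart A n] and [P31c n] have the same parity, so half of their difference is the difference of
   their rounded halves. *)
pose F : {poly R} := \poly_(n < N.+1) ((npart A n)./2%:R - (P31c n)./2%:R).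
have [W hW] : dvdr 'X^(N.+1) (E - P31R R - F *+ 2).
  pose W : {poly R} := \poly_(i < (size (E - P31R R - F *+ 2)))
    (E - P31R R - F *+ 2)`_(i + N.+1).
  exists W; apply/polyP => n; rewrite coefXnM; case: ltnP => nN.
    rewrite !coefB coefMn coef_poly nN coef_part_series // coef_P31R.
    rewrite -{1}(odd_double_half (npart A n)) -{1}(odd_double_half (P31c n)).
    by rewrite (npart_odd n hA) !natrD -!muln2 !natrM; ring.
  rewrite coef_poly subnK //; case: ltnP => // sz; rewrite nth_default //.
  by rewrite (leq_trans sz) // leq_subr.
exists (D * (G - F)); exists (V - D * W).
by rewrite [RHS]mulrBr [X in _ = _ - X]mulrCA -hV -hW -/D -/E; ring.
Qed.

(** * Arithmetic modulo 2 of a root of the quintic *)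

Section Root.
Variables (S : comNzRingType) (x : S).
Hypothesis x_root : x ^+ 5 + x ^+ 4 + x ^+ 2 + x + 1 = 0.

(* Below, q is a quotient by x^5 + x^4 + x^2 + x + 1 over F_2, and the witness is
   half of the corresponding integral remainder. *)
Lemma root_exp31 : dvdr 2%:R (x ^+ 31 - 1).
Proof.
pose q :=
  1 + x + x ^+ 3 + x ^+ 5 + x ^+ 8 + x ^+ 12 + x ^+ 14 + x ^+ 15 + x ^+ 16
  + x ^+ 17 + x ^+ 18 + x ^+ 20 + x ^+ 21 + x ^+ 24 + x ^+ 25 + x ^+ 26.
exists (
  - 1 - x - x ^+ 2 - x ^+ 3 - x ^+ 4 - x ^+ 5 *+ 2 - x ^+ 6 - x ^+ 7
  - x ^+ 8 - x ^+ 9 - x ^+ 10 - x ^+ 12 - x ^+ 13 - x ^+ 14 - x ^+ 15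
  - x ^+ 16 *+ 2 - x ^+ 17 *+ 2 - x ^+ 18 *+ 2 - x ^+ 19 *+ 2 - x ^+ 20 *+ 2
  - x ^+ 21 *+ 2 - x ^+ 22 *+ 2 - x ^+ 23 - x ^+ 24 - x ^+ 25 *+ 2
  - x ^+ 26 *+ 2 - x ^+ 27 - x ^+ 28 - x ^+ 29 - x ^+ 30).
by rewrite -[LHS]subr0 -(mulr0 q) -x_root /q; ring.
Qed.

(** Modulo 2 the roots of the quintic are the images x^(2^i) of [x] under Frobenius, and 1 + z + z^3
    + z^4 + z^5 is its reciprocal polynomial. *)
Lemma root_P31 z : exists g,
  \prod_(i < 5) (1 - x ^+ (2 ^ i) * z) = 1 + z + z ^+ 3 + z ^+ 4 + z ^+ 5 +
    g *+ 2.
Proof.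
pose q :=
  (1 + x ^+ 5 + x ^+ 6 + x ^+ 9 + x ^+ 10 + x ^+ 11) * z + (x ^+ 3 + x ^+ 4
  + x ^+ 5 + x ^+ 6 + x ^+ 7 + x ^+ 10 + x ^+ 11 + x ^+ 13 + x ^+ 15
  + x ^+ 17 + x ^+ 18 + x ^+ 19) * z ^+ 2 + (1 + x + x ^+ 3 + x ^+ 5
  + x ^+ 7 + x ^+ 10 + x ^+ 11 + x ^+ 12 + x ^+ 13 + x ^+ 15 + x ^+ 16
  + x ^+ 22 + x ^+ 23) * z ^+ 3 + (1 + x + x ^+ 3 + x ^+ 5 + x ^+ 8
  + x ^+ 12 + x ^+ 14 + x ^+ 17 + x ^+ 21 + x ^+ 25) * z ^+ 4 + (1 + x
  + x ^+ 3 + x ^+ 5 + x ^+ 8 + x ^+ 12 + x ^+ 14 + x ^+ 15 + x ^+ 16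
  + x ^+ 17 + x ^+ 18 + x ^+ 20 + x ^+ 21 + x ^+ 24 + x ^+ 25
  + x ^+ 26) * z ^+ 5.
exists (
  (- 1 - x - x ^+ 2 - x ^+ 4 - x ^+ 5 - x ^+ 6 - x ^+ 7 - x ^+ 8 - x ^+ 9
  - x ^+ 10 *+ 2 - x ^+ 11 *+ 2 - x ^+ 12 - x ^+ 13 - x ^+ 14 - x ^+ 15
  - x ^+ 16) * z + (- x ^+ 4 - x ^+ 5 - x ^+ 6 - x ^+ 7 *+ 2 - x ^+ 8 *+ 2
  - x ^+ 9 - x ^+ 10 - x ^+ 11 *+ 2 - x ^+ 12 - x ^+ 13 - x ^+ 14
  - x ^+ 15 *+ 2 - x ^+ 16 - x ^+ 17 - x ^+ 18 - x ^+ 19 *+ 2 - x ^+ 20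
  - x ^+ 21 - x ^+ 22 - x ^+ 23) * z ^+ 2 + (- 1 - x - x ^+ 2 - x ^+ 3
  - x ^+ 4 - x ^+ 5 *+ 2 - x ^+ 6 - x ^+ 7 *+ 2 - x ^+ 8 - x ^+ 9 - x ^+ 10
  - x ^+ 11 *+ 2 - x ^+ 12 *+ 2 - x ^+ 13 *+ 2 - x ^+ 14 *+ 2 - x ^+ 15 *+ 2
  - x ^+ 16 *+ 2 - x ^+ 17 *+ 2 - x ^+ 18 - x ^+ 19 - x ^+ 20 - x ^+ 21
  - x ^+ 22 - x ^+ 23 - x ^+ 24 - x ^+ 25 - x ^+ 26 - x ^+ 27
  - x ^+ 28) * z ^+ 3 + (- 1 - x - x ^+ 2 - x ^+ 3 - x ^+ 4 - x ^+ 5 *+ 2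
  - x ^+ 6 - x ^+ 7 - x ^+ 8 - x ^+ 9 - x ^+ 10 - x ^+ 12 - x ^+ 13
  - x ^+ 14 - x ^+ 16 - x ^+ 17 - x ^+ 18 - x ^+ 19 - x ^+ 21 - x ^+ 22
  - x ^+ 25 - x ^+ 26) * z ^+ 4 + (- 1 - x - x ^+ 2 - x ^+ 3 - x ^+ 4
  - x ^+ 5 *+ 2 - x ^+ 6 - x ^+ 7 - x ^+ 8 - x ^+ 9 - x ^+ 10 - x ^+ 12
  - x ^+ 13 - x ^+ 14 - x ^+ 15 - x ^+ 16 *+ 2 - x ^+ 17 *+ 2 - x ^+ 18 *+ 2
  - x ^+ 19 *+ 2 - x ^+ 20 *+ 2 - x ^+ 21 *+ 2 - x ^+ 22 *+ 2 - x ^+ 23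
  - x ^+ 24 - x ^+ 25 *+ 2 - x ^+ 26 *+ 2 - x ^+ 27 - x ^+ 28 - x ^+ 29
  - x ^+ 30 - x ^+ 31) * z ^+ 5).
rewrite -[LHS]subr0 -(mulr0 q) -x_root /q !big_ord_recl big_ord0 /= /bump /=.
rewrite !expnS !expn0 !muln1 /=.
ring.
Qed.

End Root.

(** * Sums of the divisors lying in [A], modulo powers of 2 *)

Lemma sum_divisors_nat (V : nmodType) (P : pred nat) (F : nat -> V) n :
  (0 < n)%N -> \sum_(d <- divisors n | P d) F d =
  \sum_(i < n | P i.+1) (if (i.+1 %| n)%N then F i.+1 else 0).
Proof.
move=> n_gt0.
have E : perm_eq (divisors n) [seq d <- index_iota 1 n.+1 | d %| n]%N.
  apply: uniq_perm; rewrite ?divisors_uniq ?filter_uniq ?iota_uniq // => d.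
  rewrite -dvdn_divisors // mem_filter mem_index_iota ltnS.
  by case: (boolP (d %| n)%N) => //= dn; rewrite (dvdn_gt0 n_gt0 dn) dvdn_leq.
by rewrite (perm_big _ E) /= big_filter_cond big_add1 big_mkord big_mkcondl.
Qed.

(** The Euler product times [Q] is 1 modulo 2, so [logd_cong] applies; the two sums are the
    coefficients of degree [n] of the two logarithmic derivatives. *)
Lemma part_sum_cong (R : comNzRingType) (x : R) (A : {pred nat}) k n :
  (forall y : R, y *+ 2 = 0 -> y = 0) ->
  x ^+ 5 + x ^+ 4 + x ^+ 2 + x + 1 = 0 -> npart_congr A P31 ->
  (0 < n)%N -> (2 ^ k %| n)%N ->
  dvdr (2 ^ k.+1)%:R
    (\sum_(d <- divisors n | d \in A) d%:R + \sum_(i < 5) x ^+ (2 ^ i * n)).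
Proof.
move=> two_torsion_free x_root hA n_gt0 kn.
pose Q : {poly R} := \prod_(i < 5) (1 - (x ^+ (2 ^ i))%:P * 'X^1).
have [G QE] : exists G, Q = P31R R + G *+ 2.
  have [|g gE] := @root_P31 {poly R} x%:P _ 'X.
    by rewrite -polyC1 -!polyC_exp -!polyCD x_root.
  exists g; rewrite -gE; apply: eq_bigr => i _.
  by rewrite expr1 -rmorphXn.
have [H hH] := part_euler_P31 n hA QE.
have lD : logd n (part_euler R A n)
  (\sum_(i < n | i.+1 \in A) logd_term n 1 i.+1).
  by apply: logd_prod => i _; apply: logd_factor.
have lQ : logd n Q (\sum_(i < 5) logd_term n (x ^+ (2 ^ i)) 1).
  by apply: logd_prod => i _; apply: logd_factor.
have := logd_cong two_torsion_free (logdM lD lQ) hH (leqnn n) kn.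
rewrite coefD !coef_sum sum_divisors_nat //.
rewrite (eq_bigr (fun i : 'I_n => if (i.+1 %| n)%N then i.+1%:R else 0)).
  rewrite [X in _ + X](eq_bigr (fun i : 'I_5 => x ^+ (2 ^ i * n))) // => i _.
  by rewrite coef_logd_term ?n_gt0 ?leqnn // dvd1n divn1 -exprM.
by move=> i _; rewrite coef_logd_term ?n_gt0 ?leqnn // expr1n.
Qed.

(** * Congruences for the partial sums of d S(d) *)

(* d S(d), truncated so as to be correct modulo 2^(k+1). *)
Definition dS (A : {pred nat}) (k d : nat) : nat :=
  d * \sum_(j < k.+1) chi A (2 ^ j * d) * 2 ^ j.

(** Divisors of [2 ^ k * m] are grouped by their odd part [d]; those lying in [A] add up to [d]
    times a truncation of S(d). *)
Lemma sum_divisors_dS (R : comNzRingType) (A : {pred nat}) k m :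
  odd m -> \sum_(d <- divisors (2 ^ k * m) | d \in A) d%:R =
  \sum_(d <- divisors m) (dS A k d)%:R :> R.
Proof.
move=> m_odd; have m_gt0 := odd_gt0 m_odd.
rewrite big_mkcond sum_divisors_pfactor ?coprime2n // exchange_big /=.
apply: eq_bigr => d _; rewrite /dS big_distrr natr_sum /=.
apply: eq_bigr => j _; rewrite /chi; case: (_ \in A); rewrite ?mul0n ?muln0 //.
by rewrite mul1n mulnC.
Qed.

Lemma exp2k_cong (R : comNzRingType) (y : R) k :
  dvdr 2%:R (y - 1) -> dvdr (2 ^ k.+1)%:R (y ^+ (2 ^ k) - 1).
Proof.
move=> hy; elim: k => [|k [z zE]]; first by rewrite expr1.
exists (z + (2 ^ k)%:R * z ^+ 2).
have E : y ^+ (2 ^ k) = 1 + (2 ^ k.+1)%:R * z by rewrite -zE; ring.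
by rewrite [X in _ ^+ X]expnSr exprM E !expnS !natrM; ring.
Qed.

Lemma dvdr_expB (R : comNzRingType) (t a b : R) n :
  dvdr t (a - b) -> dvdr t (a ^+ n - b ^+ n).
Proof. by rewrite subrXX mulrC => h; apply: dvdrM. Qed.

Lemma expr_modn_cong (R : comNzRingType) (t b : R) p n :
  dvdr t (b ^+ p - 1) -> dvdr t (b ^+ n - b ^+ (n %% p)).
Proof.
move=> h; rewrite {1}(divn_eq n p) exprD mulnC exprM.
rewrite -[X in _ - X]mul1r -mulrBl mulrC; apply: dvdrM.
by have := dvdr_expB (n %/ p) h; rewrite expr1n.
Qed.

Section Congruences.
Variables (R : comNzRingType) (x : R) (A : {pred nat}).
Hypothesis two_torsion_free : forall y : R, y *+ 2 = 0 -> y = 0.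
Hypothesis dvd_nat : forall k c, dvdr ((2 ^ k)%:R : R) c%:R -> (2 ^ k %| c)%N.
Hypothesis x_root : x ^+ 5 + x ^+ 4 + x ^+ 2 + x + 1 = 0.
Hypothesis hA : npart_congr A P31.

(** This is a 31st root of unity modulo 2^(k+1), and x^(2^i n) is its power of exponent 2^i m when n
    = 2^k m. *)
Let b k := x ^+ (2 ^ k).

Lemma b_exp31 k : dvdr (2 ^ k.+1)%:R (b k ^+ 31 - 1).
Proof. by rewrite /b exprAC; apply: exp2k_cong; apply: root_exp31. Qed.

Lemma sum_dS_cong k m : odd m ->
  dvdr (2 ^ k.+1)%:R
    (\sum_(d <- divisors m) (dS A k d)%:R + \sum_(i < 5) b k ^+ (2 ^ i * m)).
Proof.
move=> m_odd; rewrite -sum_divisors_dS //.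
have n_gt0 : (0 < 2 ^ k * m)%N by rewrite muln_gt0 expn_gt0 (odd_gt0 m_odd).
have := part_sum_cong two_torsion_free x_root hA n_gt0
  (dvdn_mulr m (dvdnn (2 ^ k)%N)).
by congr (dvdr _ (_ + _)); apply: eq_bigr => i _; rewrite /b -exprM mulnCA.
Qed.

(** By Moebius inversion: summed over the divisors [d] of [n], the terms at [d] and [31 * d] give
    the divisor sum at [31 * n], which is -5 since five 31st powers equal to 1 appear on the other
    side. *)
Lemma dS31_cong k m : odd m -> coprime m 31 -> m != 1%N ->
  (2 ^ k.+1 %| dS A k m + dS A k (31 * m))%N.
Proof.
move=> m_odd m_31 m_neq1; apply: dvd_nat.
(* The term 5 at [d = 1] makes every divisor sum vanish modulo 2^(k+1); it is absent at [m] because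
   [m != 1]. *)
pose f d : R := (dS A k d + dS A k (31 * d))%:R + (d == 1%N)%:R *+ 5.
have -> : (dS A k m + dS A k (31 * m))%:R = f m.
  by rewrite /f (negbTE m_neq1) mul0rn addr0.
apply: divisor_sum_inj => [|n nm]; first exact: odd_gt0.
have n_odd := dvdn_odd nm m_odd; have n_gt0 := odd_gt0 n_odd.
have n_31 := coprime_dvdl nm m_31.
have -> : \sum_(d <- divisors n) f d =
    \sum_(d <- divisors (31 * n)) (dS A k d)%:R + 5%:R.
  rewrite big_split /=; congr (_ + _).
    rewrite -[31%N in RHS]expn1 sum_divisors_pfactor // 1?coprime_sym //.
    rewrite big_ord_recl big_ord1 /= -big_split /=; apply: eq_bigr => d _.
    by rewrite expn0 mul1n expn1 natrD.
  rewrite (bigD1_seq 1%N) ?divisors_uniq -?dvdn_divisors ?dvd1n //=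
    big1 ?addr0 //.
  by move=> d /negbTE ->; rewrite mul0rn.
have n31_odd : odd (31 * n) by rewrite oddM n_odd.
have := sum_dS_cong k n31_odd; set s := \sum_(d <- _) _.
have -> : s + 5%:R = (s + \sum_(i < 5) b k ^+ (2 ^ i * (31 * n)))
   - \sum_(i < 5) (b k ^+ (2 ^ i * (31 * n)) - 1).
  by rewrite sumrB sumr_const card_ord; ring.
move=> h; apply: dvdrB => //; apply: dvdr_sum => i _.
by rewrite mulnCA exprM; have := dvdr_expB (2 ^ i * n) (b_exp31 k);
  rewrite expr1n.
Qed.

End Congruences.

(** * Nonvanishing of S(m) *)

Local Notation pZtoC := (map_poly (intr : int -> algC)).

(** The minimal polynomial of [y] is the [p]-th cyclotomic polynomial, of size [p], and it divides
    [Q] over the rationals. *)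
Lemma root_prim_size (p : nat) (Q : {poly int}) (y : algC) :
  prime p -> p.-primitive_root y -> root (pZtoC Q) y -> Q != 0 ->
    (p <= size Q)%N.
Proof.
move=> p_pr prim_y; have [q [qE _] qP] := minCpolyP y.
have sz : size q = p.
  have := congr1 (fun r : {poly algC} => size r) (minCpoly_cyclotomic prim_y).
  by rewrite /= size_cyclotomic totient_prime // prednK ?prime_gt0 //
    qE size_map_poly.
have -> : pZtoC Q = map_poly (ratr : rat -> algC) (map_poly intr Q).
  by rewrite -map_poly_comp; apply: eq_map_poly => z /=; rewrite ratr_int.
rewrite qP => /dvdp_leq h Q0.
have := h _; rewrite sz size_map_inj_poly //; first apply.
  by rewrite map_poly_eq0_id0 ?intr_eq0 ?lead_coef_eq0.
exact: intr_inj.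
Qed.

(** The constant [c] is the resultant. A common complex root of [Q] and the cyclotomic polynomial
    would be a primitive [p]-th root of unity, hence a root of Q / X, which is nonzero of size less
    than [p]. *)
Lemma prime_cyclotomic_coprime (p : nat) (Q : {poly int}) :
  prime p -> Q != 0 -> (size Q <= p)%N -> Q`_0 = 0 ->
  exists c u v, c != 0 /\ c%:P = u * Q + v * \sum_(i < p) 'X^i.
Proof.
move=> p_pr Q_neq0 Q_size Q0; set G := \sum_(i < p) 'X^i.
have p_gt1 := prime_gt1 p_pr.
have [Q' QE] : exists Q', Q = Q' * 'X.
  by have /factor_theorem[Q' ->] : root Q 0;
    [rewrite /root horner_coef0 Q0 | exists Q'; rewrite subr0].
have Q'_neq0 : Q' != 0 by apply: contraNneq Q_neq0; rewrite QE => ->;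
  rewrite mul0r.
have szQ : size Q = (size Q').+1 by rewrite QE size_mulX.
have szG : size G = p.
  rewrite /G -(prednK (prime_gt0 p_pr)) big_ord_recr /= addrC size_polyDl
    size_polyXn //.
  rewrite ltnS; apply: (leq_trans (size_sum _ _ _)); apply/bigmax_leqP => i _.
  by rewrite size_polyXn.
have szQ1 : (1 < size Q)%N by rewrite szQ ltnS size_poly_gt0.
have szG1 : (1 < size G)%N by rewrite szG.
have [[u v] /= [_ _ E]] := resultant_in_ideal szQ1 szG1.
exists (resultant Q G), u, v; split => //; rewrite resultant_eq0 -leqNgt leqNgt.
apply/negP => gcd_size; pose g := gcdp Q G.
have szg : (1 < size (pZtoC g))%N by rewrite size_map_inj_poly //;
  exact: intr_inj.
have [y gy] : exists y, root (pZtoC g) y.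
  by apply/closed_rootP; rewrite gtn_eqF.
have dv_root (H : {poly int}) : g %| H -> root (pZtoC H) y.
  case/Pdiv.Idomain.dvdpP => -[c h] /= c0 E1.
  have := congr1 (fun r => (pZtoC r).[y]) E1.
  rewrite /= rmorphM /= map_polyZ !hornerE (eqP gy) mulr0 => /eqP.
  by rewrite mulf_eq0 intr_eq0 (negbTE c0).
have Gy := dv_root G (dvdp_gcdr _ _); have Qy := dv_root Q (dvdp_gcdl _ _).
have pG : pZtoC G = \sum_(i < p) 'X^i.
  by rewrite rmorph_sum /=; apply: eq_bigr => i _; rewrite map_polyXn.
have y_p : y ^+ p = 1.
  apply/eqP; rewrite -subr_eq0 subrX1 mulf_eq0; apply/orP; right.
  move: Gy; rewrite pG /root horner_sum;
    under eq_bigr => i _ do rewrite hornerXn.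
  by [].
have y_neq1 : y != 1.
  apply/eqP => y1; move: Gy; rewrite pG /root horner_sum.
  rewrite (eq_bigr (fun=> 1)) => [|i _]; last by rewrite hornerXn y1 expr1n.
  by rewrite sumr_const card_ord pnatr_eq0 gtn_eqF // prime_gt0.
have prim_y : p.-primitive_root y.
  have [d prim_d d_p] := prim_order_exists (prime_gt0 p_pr) y_p.
  move/primeP: p_pr => [_ /(_ _ d_p)/orP[]/eqP dE]; last by rewrite -dE.
  by have := prim_expr_order prim_d; rewrite dE expr1 => /eqP;
    rewrite (negbTE y_neq1).
have y_neq0 : y != 0.
  apply/eqP => y0; move/eqP: y_p.
  by rewrite y0 expr0n gtn_eqF ?prime_gt0 //= eq_sym oner_eq0.
have Q'y : root (pZtoC Q') y.
  by move: Qy; rewrite QE rmorphM /= map_polyX /root hornerMX mulf_eq0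
    (negbTE y_neq0) orbF.
have := root_prim_size p_pr prim_y Q'y Q'_neq0.
by rewrite leqNgt -szQ Q_size.
Qed.

(** The fifth roots of unity modulo 31 are 1, 2, 4, 8, 16, and 2^k 3^j with k < 5 and j < 6 is one
    of them only for j = 0; both facts are checked by enumeration. *)
Lemma P0_expr5 p : prime p -> odd p -> p != 31 -> p%:R ^+ 5 = 1 :> 'F_31 ->
  P0 p.
Proof.
move=> p_pr p_odd p31; rewrite -natrX => /(congr1 val);
  rewrite /= !val_Fp_nat // => E.
rewrite /P0 p_pr p_odd p31 /=.
have pr : (p %% 31 \in [:: 1; 2; 4; 8; 16])%N.
  have chk : all (fun r => (r * r %% 31 * (r * r %% 31) %% 31 * r %% 31 == 1)
      ==> (r \in [:: 1; 2; 4; 8; 16]))%N (iota 0 31) by vm_compute.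
  apply: (implyP (allP chk (p %% 31)%N _)); first by rewrite mem_iota ltn_mod.
  have := E; rewrite (_ : p ^ 5 = p * p * (p * p) * p)%N; last by ring.
  by rewrite -modnMm -(modnMm (p * p)) -(modnMm p p) modnMml modnMmr => ->.
(* If no index is found, [ell] takes its default value 0 and the goal holds at once. *)
rewrite /ell; case: pickP => [j /existsP[k /eqP E2]|//] /=.
have chk : all
  (fun k => all (fun j => (2 ^ k * 3 ^ j %% 31 \in [:: 1; 2; 4; 8; 16])
   ==> (j == 0))%N (iota 0 6)) (iota 0 5) by vm_compute.
rewrite -val_eqE /=.
apply: (implyP (allP (allP chk k _) j _)); rewrite ?mem_iota /= ?add0n //.
by rewrite -E2.
Qed.

Section NonVanishing.
Variables (R : comNzRingType) (x : R) (A : {pred nat}).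
Hypothesis two_torsion_free : forall y : R, y *+ 2 = 0 -> y = 0.
Hypothesis dvd_nat : forall k c, dvdr ((2 ^ k)%:R : R) c%:R -> (2 ^ k %| c)%N.
Hypothesis x_root : x ^+ 5 + x ^+ 4 + x ^+ 2 + x + 1 = 0.
Hypothesis hA : npart_congr A P31.

Lemma dvdr2_odd c (y : R) : odd c -> dvdr 2%:R (c%:R * y) -> dvdr 2%:R y.
Proof.
move=> c_odd h; have -> : y = c%:R * y - 2%:R * (c./2%:R * y).
  have cE : c = (1 + 2 * c./2)%N by rewrite mul2n -{1}(odd_double_half c) c_odd.
  by rewrite {1}cE; ring.
by apply: dvdrB => //; exists (c./2%:R * y).
Qed.

Lemma dvdr_exp2_cancel s t (y : R) :
  dvdr (2 ^ (s + t))%:R ((2 ^ s)%:R * y) -> dvdr (2 ^ t)%:R y.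
Proof.
case=> z; elim: s => [|s IH] E; first by exists z; rewrite -[LHS]mul1r E.
apply: IH; apply/eqP; rewrite -subr_eq0; apply/eqP/two_torsion_free.
move/eqP: E; rewrite -subr_eq0 => /eqP <-; rewrite addSn !expnS !natrM; ring.
Qed.

Lemma root_not_cong1 : ~ dvdr 2%:R (x - 1).
Proof.
move=> [y yE].
have : dvdr (2 ^ 1)%:R (1%:R : R).
  (* The quintic is 5 + (x - 1) q(x), where q is the quartic displayed here; with x - 1 = 2 y, its
     vanishing gives 1 = 2 (- 2 - y q(x)). *)
  exists (- 2%:R - y * (x ^+ 4 + x ^+ 3 *+ 2 + x ^+ 2 *+ 2 + x *+ 3 + 4%:R)).
  rewrite mulrBr mulrA -yE -[LHS]subr0 -x_root; ring.
by move/dvd_nat.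
Qed.

(* If Q(x^(2^k)) were 0 modulo 2^(k+1) for all k, so would be a nonzero integer
   multiple of x^(2^k) - 1, Q being coprime to the 31st cyclotomic polynomial. *)
Lemma horner_nonzero (Q : {poly int}) :
  Q != 0 -> (size Q <= 31)%N -> Q`_0 = 0 ->
  ~ (forall k, dvdr (2 ^ k.+1)%:R (map_poly intr Q).[x ^+ (2 ^ k)]).
Proof.
move=> Q_neq0 szQ Q0 hQ.
have [c [u [v [c_neq0 E]]]] := prime_cyclotomic_coprime (isT : prime 31) Q_neq0
  szQ Q0.
have c_gt0 : (0 < `|c|)%N by rewrite absz_gt0.
have [c' c'_odd cE] := pfactor_coprime (isT : prime 2) c_gt0.
rewrite coprime2n in c'_odd; set s := logn 2 `|c| in cE.
(* [s] is the valuation of [c] at 2. With [k] a multiple of 5, b = x^(32^s) is congruent to [x]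
   modulo 2, and k + 1 = (s + 1) + 4 s leaves a factor 2 once 2^s is cancelled. *)
pose k := (5 * s)%N; pose b := x ^+ (2 ^ k).
apply: root_not_cong1.
have hc : dvdr (2 ^ k.+1)%:R (c%:~R * (b - 1)).
  have /(congr1 (fun p : {poly int} => (map_poly (intr : int -> R) p).[b])) :=
    E.
  rewrite map_polyC /= hornerC => ->.
  rewrite rmorphD !rmorphM /= hornerD !hornerM.
  rewrite rmorph_sum /= horner_sum.
  have -> : \sum_(i < 31) (map_poly intr 'X^i).[b] = \sum_(i < 31) b ^+ i :> R.
    by apply: eq_bigr => i _; rewrite map_polyXn hornerXn.
  rewrite mulrDl; apply: dvdrD.
    by rewrite mulrAC; apply: dvdrM; apply: hQ.
  rewrite -mulrA [_ * (b - 1)]mulrC -subrX1; apply: dvdrM; exact: b_exp31.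
have {}hc : dvdr 2%:R (b - 1).
  apply: (dvdr2_odd c'_odd); apply: (@dvdr_exp2_cancel s 1).
  have [w wE] : dvdr (2 ^ k.+1)%:R (`|c|%N%:R * (b - 1)).
    case: hc => w; case: (intP c) => [|n|n]; rewrite ?absz_nat //= => wE;
      first by exists w.
      by exists w.
    by exists (- w); rewrite mulrN -wE mulrNz mulNr opprK.
  exists ((2 ^ (4 * s))%:R * w);
    rewrite [LHS]mulrA -natrM [(_ * c')%N]mulnC -cE wE [RHS]mulrA -natrM -expnD.
  by congr (_%:R * _); congr (2 ^ _)%N; rewrite /k; lia.
have -> : x - 1 = (b - 1) - (b - x) by ring.
apply: dvdrB => //; rewrite /b /k expnM.
elim: {k hQ hc b cE} s => [|s IH]; first by rewrite expr1 subrr; apply: dvdr0.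
have -> : x ^+ ((2 ^ 5) ^ s.+1) - x = (x ^+ ((2 ^ 5) ^ s)) ^+ 32 - x ^+ 32 +
  x * (x ^+ 31 - 1).
  by rewrite (expnSr (2 ^ 5)) exprM; move: (x ^+ ((2 ^ 5) ^ s)) => y; ring.
apply: dvdrD; first exact: dvdr_expB.
by apply: dvdrM; apply: root_exp31.
Qed.

(** Moebius inversion of the polynomials [h n] gives [f m], whose value at x^(2^k) is congruent to
    [- dS A k m] modulo 2^(k+1). It is nonzero because its image under [theta] is, so
    [horner_nonzero] applies. *)
Lemma dS_nonzero m : odd m -> coprime m 31 ->
  (forall p, (p %| m)%N -> ~~ P0 p) ->
  ~ (forall k, dvdr (2 ^ k.+1)%:R ((dS A k m)%:R : R)).
Proof.
move=> m_odd m_31 m_P0 hS; have m_gt0 := odd_gt0 m_odd.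
pose h n : {poly int} := \sum_(i < 5) 'X^((2 ^ i * n) %% 31).
have [f fE] := divisor_sum_surj h m.
have {}fE n : (n %| m)%N -> \sum_(d <- divisors n) f d = h n.
  by move=> nm; rewrite fE // (dvdn_gt0 m_gt0 nm) dvdn_leq.
have odd_dvd n : (n %| m)%N -> odd n by move=> nm; apply: dvdn_odd nm m_odd.
have co_dvd n : (n %| m)%N -> coprime n 31 by move=> nm;
  apply: coprime_dvdl m_31.
have dvd0 (S : comNzRingType) (y : S) : dvdr 0 y -> y = 0 by case=> z ->;
  rewrite mul0r.
have dvd00 (S : comNzRingType) (y : S) : y = 0 -> dvdr 0 y by move->;
  apply: dvdr0.
(* The exponents in [h n] lie strictly between 0 and 31, since 31 does not divide 2^i n.
   Divisibility by 0 being equality to 0, [divisor_sum_inj] carries this over to [f m]. *)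
have coef_f i : (i == 0%N) || (31 <= i)%N -> (f m)`_i = 0.
  move=> hi; apply: dvd0;
    apply: (@divisor_sum_inj _ 0 (fun d => (f d)`_i)) => // n nm.
  apply: dvd00; rewrite -coef_sum fE // /h coef_sum big1 // => j _;
    rewrite coefXn.
  case/orP: hi => [/eqP ->|hi];
    last by rewrite gtn_eqF // (leq_trans _ hi) // ltn_mod.
  case: eqP => // /esym/eqP;
    rewrite -/(dvdn 31 _) Gauss_dvdr ?coprimeXr // => h31.
  by have := co_dvd n nm; rewrite coprime_sym prime_coprime // h31.
(* theta sends X^n to the character n^5 of (Z/31)^*, under which 2 is trivial. *)
pose theta (q : {poly int}) : 'F_31 := \sum_(r < 31) (q`_r)%:~R * r%:R ^+ 5.
pose psi p : 'F_31 := p%:R ^+ 5.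
(* By [divisor_sum_mult], this is the Moebius inverse of n^5 on the divisors of [m], in factored
   form. *)
pose g n := \prod_(p < m.+1 | prime p)
  (if logn p n is e.+1 then psi p ^+ e.+1 - psi p ^+ e else 1).
have g_sum n : (n %| m)%N -> \sum_(d <- divisors n) g d = n%:R ^+ 5.
  move=> nm; have n_gt0 := dvdn_gt0 m_gt0 nm.
  have nm' : (0 < n <= m)%N by rewrite n_gt0 dvdn_leq.
  apply: (etrans (divisor_sum_mult psi nm')).
  rewrite -natrX -[X in _ = (X ^ 5)%:R](partnT n_gt0)
    (widen_partn _ (dvdn_leq m_gt0 nm)).
  rewrite big_mkord natrX natr_prod -prodrXl [LHS]big_mkcond;
    apply: eq_bigr => p _.
  rewrite natrX -exprM mulnC exprM; case: ifP => // p_pr.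
  by rewrite lognE p_pr /= expr1n.
have g_neq0 : g m != 0.
  apply/prodf_neq0 => p p_pr; case E : (logn p m) => [|e];
    first exact: oner_neq0.
  have pm : (p %| m)%N.
    have : (0 < logn p m)%N by rewrite E.
    by rewrite logn_gt0 mem_primes => /and3P[].
  have p31 : (p : nat) != 31%N.
    by apply: contraTneq (co_dvd _ pm) => ->.
  (* The factor is (p^5 - 1) p^(5 e): the first term is nonzero because [p] is not in [P0], the
     second because [p] is not 31. *)
  rewrite exprS -[X in _ - X]mul1r -mulrBl mulf_neq0 //.
    rewrite subr_eq0; apply: contraNneq (m_P0 _ pm) => psi1.
    exact: (P0_expr5 p_pr (odd_dvd _ pm) p31 psi1).
  rewrite !expf_neq0 // -(dvdn_pcharf (pchar_Fp (isT : prime 31)))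
    dvdn_prime2 //.
  by rewrite eq_sym.
(* Both sides have divisor sums 5 n^5: each of the five monomials of [h n] is sent to (2^i n)^5 =
   n^5, as 2^5 = 1 modulo 31. *)
have theta_f : theta (f m) = 5%:R * g m.
  apply/eqP; rewrite -subr_eq0; apply/eqP/dvd0.
  apply: (@divisor_sum_inj _ 0 (fun d => theta (f d) - 5%:R * g d)) => // n nm.
  apply: dvd00; rewrite sumrB -big_distrr /= g_sum // /theta exchange_big /=.
  rewrite (eq_bigr (fun r : 'I_31 => ((h n)`_r)%:~R * r%:R ^+ 5)); last first.
    by move=> r _; rewrite -big_distrl /= -fE // coef_sum -rmorph_sum.
  have -> : 5%:R * n%:R ^+ 5 = \sum_(i < 5) n%:R ^+ 5 :> 'F_31.
    by rewrite sumr_const card_ord mulr_natl.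
  apply/eqP; rewrite subr_eq0; apply/eqP.
  under eq_bigr => r _ do rewrite /h coef_sum rmorph_sum big_distrl /=.
  rewrite exchange_big /=; apply: eq_bigr => i _.
  have lt31 : ((2 ^ i * n) %% 31 < 31)%N by rewrite ltn_mod.
  rewrite (bigD1 (Ordinal lt31)) //= coefXn eqxx mul1r big1 ?addr0 => [|r].
    rewrite Fp_nat_mod // natrM exprMn natrX exprAC.
    have -> : 2%:R ^+ 5 = 1 :> 'F_31 by apply/eqP.
    by rewrite expr1n mul1r.
  by rewrite -val_eqE /= coefXn => /negbTE ->; rewrite mul0r.
have f_neq0 : f m != 0.
  apply: contraTneq g_neq0 => f0; rewrite negbK; apply/eqP.
  have : 5%:R * g m = 0.
    by rewrite -theta_f f0 /theta big1 // => r _; rewrite coef0 mul0r.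
  by move/eqP; rewrite mulf_eq0 => /orP[]// /eqP.
have f_size : (size (f m) <= 31)%N.
  by apply/leq_sizeP => j hj; apply: coef_f; rewrite hj orbT.
apply: (horner_nonzero f_neq0 f_size (coef_f 0%N isT)) => k.
set t := (2 ^ k.+1)%:R; set b := x ^+ (2 ^ k).
pose ev (q : {poly int}) := (map_poly (intr : int -> R) q).[b].
rewrite -[X in dvdr _ X]/(ev (f m)).
have -> : ev (f m) = (ev (f m) + (dS A k m)%:R) - (dS A k m)%:R by ring.
apply: dvdrB; last exact: hS.
apply: (@divisor_sum_inj _ t (fun d => ev (f d) + (dS A k d)%:R)) => // n nm.
rewrite big_split /= /ev -horner_sum -rmorph_sum fE // addrC.
have := sum_dS_cong two_torsion_free x_root hA k (odd_dvd n nm);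
  rewrite -/b -/t.
set s := \sum_(d <- _) _ => hs.
have -> : s + (map_poly intr (h n)).[b] = s + \sum_(i < 5) b ^+ (2 ^ i * n)
  - \sum_(i < 5) (b ^+ (2 ^ i * n) - b ^+ (2 ^ i * n %% 31)).
  have -> : (map_poly intr (h n)).[b] = \sum_(i < 5) b ^+ (2 ^ i * n %% 31).
    rewrite /h rmorph_sum horner_sum /=; apply: eq_bigr => i _.
    by rewrite map_polyXn hornerXn.
  by rewrite sumrB; ring.
apply: dvdrB => //; apply: dvdr_sum => i _.
by apply: expr_modn_cong; apply: b_exp31.
Qed.
End NonVanishing.

(** * Algebraic integers *)

(** The ring of algebraic integers meets the hypotheses made on [R] above: it contains a suitable
    [x], has no 2-torsion, and 2^k divides an integer in it only if it does so in Z. *)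
Record algint := AlgInt { algint_val : algC; _ : algint_val \in Aint }.
HB.instance Definition _ := [isSub for algint_val].
HB.instance Definition _ := [Choice of algint by <:].
HB.instance Definition _ := [SubChoice_isSubComNzRing of algint by <:].

Lemma algint_2torsion (y : algint) : y *+ 2 = 0 -> y = 0.
Proof.
move=> /(congr1 val); rewrite rmorphMn rmorph0 => /eqP;
  rewrite mulrn_eq0 /= => /eqP y0.
exact: val_inj.
Qed.

(** The quotient c / 2^k is rational and an algebraic integer, hence an integer. *)
Lemma algint_dvd_nat k c : dvdr ((2 ^ k)%:R : algint) c%:R -> (2 ^ k %| c)%N.
Proof.
case=> -[y y_int] /(congr1 val); rewrite rmorphM !rmorph_nat /= => E.
have two_neq0 : (2 ^ k)%:R != 0 :> algC by rewrite pnatr_eq0 expn_eq0.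
have yE : y = c%:R / (2 ^ k)%:R by rewrite E mulrAC divff // mul1r.
have : y \in Num.int.
  by apply: Cint_rat_Aint => //; rewrite yE rpred_div ?rpred_nat.
case/intrP=> z zE; move: E;
  rewrite zE -[c%:R]/(c%:Z%:~R) -[(2 ^ k)%:R]/((2 ^ k)%N%:Z%:~R) -rmorphM /=.
move/intr_inj => /(congr1 absz); rewrite abszM !absz_nat => ->.
exact: dvdn_mulr.
Qed.

Lemma algint_root_exists :
  exists x : algint, x ^+ 5 + x ^+ 4 + x ^+ 2 + x + 1 = 0.
Proof.
pose p : {poly algC} := 'X^5 + ('X^4 + 'X^2 + 'X + 1).
have szq : (size ('X^4 + 'X^2 + 'X + 1 : {poly algC})%R < 6)%N.
  apply/leq_sizeP => j hj; rewrite !coefD !coefXn coefX coef1.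
  by case: j hj => [|[|[|[|[|j]]]]] // _; rewrite !addr0.
have szp : size p = 6%N by rewrite size_polyDl size_polyXn.
have [x px] : exists x, root p x by apply/closed_rootP; rewrite szp.
have x_int : x \in Aint.
  apply: (root_monic_Aint px).
    by rewrite monicE lead_coefDl ?size_polyXn // lead_coefXn.
  by apply/polyOverP => i; rewrite !coefD !coefXn coefX coef1 -!natrD;
    exact: rpred_nat.
exists (AlgInt x_int); apply: val_inj.
rewrite !rmorphD !rmorphXn rmorph1 rmorph0 /=.
by move: px; rewrite /root /p !hornerD !hornerXn hornerX hornerC => /eqP px;
  rewrite -[RHS]px !addrA.
Qed.

(** * Binary digits of 2-adic integers *)

Section Z2adicDigits.

Lemma zres_modn (x : Z2adic) n k : (zres x (n + k) %% 2 ^ n)%N = zres x n.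
Proof.
elim: k => [|k IH]; first by rewrite addn0 zres_mod.
by rewrite -IH [in RHS]zres_coh addnS modn_dvdm // dvdn_exp2l // leq_addr.
Qed.

Lemma zres_lt (x : Z2adic) n : (zres x n < 2 ^ n)%N.
Proof. by rewrite -zres_mod ltn_mod expn_gt0. Qed.

Lemma zres_exp2M (x : Z2adic) g n :
  zres (2%:R ^+ g * x) (g + n) = (2 ^ g * zres x n)%N.
Proof.
rewrite -natrX zresM zres_nat modnMml expnD -muln_modr; congr (_ * _)%N.
by rewrite addnC zres_modn.
Qed.

Lemma exp2_divpow2 (x : Z2adic) n : zres x n = 0%N ->
  x = 2%:R ^+ n * divpow2 n x.
Proof.
move=> x0; apply: Z2adic_ext => k;
  rewrite -(zres_modn x k n) -(zres_modn (_ * _) k n).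
rewrite [in RHS]addnC zres_exp2M /=.
have [q ->] : exists q, zres x (k + n) = (q * 2 ^ n)%N.
  by apply/dvdnP; rewrite addnC /dvdn zres_modn x0.
by rewrite mulnK ?expn_gt0 // modnMmr mulnC.
Qed.

Lemma divpow2K (x : Z2adic) n : divpow2 n (2%:R ^+ n * x) = x.
Proof.
apply: Z2adic_ext => k.
rewrite -[LHS]/((zres (2%:R ^+ n * x)%R (k + n) %/ 2 ^ n) %% 2 ^ k)%N.
rewrite [(k + n)%N]addnC zres_exp2M mulKn ?expn_gt0 //.
exact: zres_mod.
Qed.

Lemma z2eqmodP n (x y : Z2adic) : z2eqmod n x y <-> zres x n = zres y n.
Proof.
split=> [[t ->]|E].
  by rewrite -natrX /= zres_nat modnn mul0n mod0n addn0 zres_mod.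
exists (divpow2 n (x - y)); rewrite -exp2_divpow2; first by rewrite addrC subrK.
by rewrite /= modnDmr E subnKC ?zres_le // modnn.
Qed.

Lemma z2eqmod_unitM n (u x y : Z2adic) : u \is a GRing.unit ->
  z2eqmod n x y <-> z2eqmod n (u * x) (u * y).
Proof.
move=> u_unit; split=> -[t E].
  by exists (u * t); rewrite E mulrDr mulrCA.
exists (u^-1 * t); rewrite -[LHS](mulKr u_unit) E mulrDr mulKr //.
by rewrite [in RHS]mulrCA.
Qed.

Lemma zunit_odd a : odd a -> (a%:R : Z2adic) \is a GRing.unit.
Proof.
move=> a_odd; change (odd (zres (a%:R : Z2adic) 1)).
by rewrite zres_nat odd_mod.
Qed.

(** The partial sum of order [g + r] is 2^g times the residue of [D] modulo 2^r, so [c (g + r)] is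
    the binary digit of index [r] of [D]. Digit 0 is 1 as [D] is odd; for [r > 0] the digit is 1
    exactly when the odd residue of [D] modulo 2^(r+1) exceeds 2^r. *)
Lemma z2series_digits (c : nat -> bool) (D : Z2adic) g :
  D \is a GRing.unit -> z2series (fun k => c k : nat) = 2%:R ^+ g * D ->
  [/\ forall k, (k < g)%N -> ~~ c k, c g
    & forall r, (0 < r)%N ->
        c (g + r)%N <-> exists l, l \in Sr r /\ z2eqmod r.+1 D l%:R].
Proof.
move=> D_unit SE; pose s n := (\sum_(j < n) c j * 2 ^ j)%N.
have s_lt n : (s n < 2 ^ n)%N.
  elim: n => [|n IH]; first by rewrite /s big_ord0.
  rewrite /s big_ord_recr /= -/(s n) expnS mul2n -addnn; case: (c n); lia.
have sE r : s (g + r)%N = (2 ^ g * zres D r)%N.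
  by rewrite -zres_exp2M -SE /= -/(s _) modn_small.
have digit r : zres D r.+1 = (zres D r + c (g + r)%N * 2 ^ r)%N.
  apply/eqP; rewrite -(@eqn_pmul2l (2 ^ g)) ?expn_gt0 // mulnDr -!sE.
  by rewrite addnS {1}/s big_ord_recr /= -/(s _) expnD mulnCA.
have D0 : zres D 0 = 0%N by have := zres_lt D 0; case: (zres D 0).
have D_odd r : odd (zres D r.+1) by rewrite odd_zres.
split=> [k kg||r r_gt0].
- have := sE 0%N; rewrite D0 muln0 addn0 => /eqP.
  rewrite /s sum_nat_eq0 => /forallP/(_ (Ordinal kg)) /=.
  by rewrite muln_eq0 expn_eq0 /= orbF; case: (c k).
- by have := D_odd 0%N; rewrite digit D0 addn0 muln1; case: (c g).
have Dr_lt := zres_lt D r; have DrS_lt := zres_lt D r.+1.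
split=> [cr|[l [/and3P[l_odd l_gt l_lt] /z2eqmodP]]].
  (* The witness is the residue of [D] itself. It is strictly above 2^r because [zres D r] is odd,
     hence positive, for [r > 0]. *)
  exists (zres D r.+1); split; last by apply/z2eqmodP;
    rewrite zres_nat modn_small.
  rewrite inE D_odd DrS_lt andbT /= digit cr mul1n.
  have : odd (zres D r) by case: r r_gt0 {Dr_lt DrS_lt cr}.
  by case: (zres D r) => // n _; lia.
rewrite zres_nat modn_small // => E; move: l_gt; rewrite -E digit.
by case: (c _) => //; rewrite mul0n addn0 ltnNge ltnW.
Qed.

End Z2adicDigits.

(** * From congruences and digits to S(m) and S(31 m) *)

Lemma zres_dS A d k : zres (d%:R * S2 A d) k.+1 = (dS A k d %% 2 ^ k.+1)%N.
Proof. by rewrite zresM zres_nat /= modnMml modnMmr. Qed.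

(** Turns the digit condition on [z] into the form of the theorem, with y = m and y z = Z(m). *)
Lemma z2eqmod_divl n (l y z : Z2adic) :
  l \is a GRing.unit -> y \is a GRing.unit ->
  z2eqmod n z l <-> z2eqmod n y (l^-1 * (y * z)).
Proof.
move=> l_unit y_unit.
have u_unit : l^-1 * y \is a GRing.unit by rewrite unitrM unitrV l_unit.
have yE : l^-1 * y * l = y by rewrite mulrAC mulVr // mul1r.
apply: (iff_trans (z2eqmod_unitM n z l u_unit)); rewrite yE mulrA.
by split=> /z2eqmodP E; apply/z2eqmodP.
Qed.

Lemma z2eqmod_divlN n (l y z u : Z2adic) :
  l \is a GRing.unit -> y \is a GRing.unit -> u \is a GRing.unit ->
  z2eqmod n (- (u^-1 * z)) l <-> z2eqmod n y (- (u * l)^-1 * (y * z)).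
Proof.
move=> l_unit y_unit u_unit.
apply: (iff_trans (z2eqmod_divl n _ l_unit y_unit)).
have -> // : l^-1 * (y * - (u^-1 * z)) = - (u * l)^-1 * (y * z).
by rewrite invrM // !mulrN mulNr -mulrA [u^-1 * (y * z)]mulrCA.
Qed.

Section Theorem3.
Variables (A : {pred nat}) (m : nat).
Hypothesis hA : npart_congr A P31.
Hypotheses (m_odd : odd m) (m_31 : coprime m 31).

(** The two sides agree modulo every 2^(k+1) by [dS31_cong], taken over the ring [algint]. *)
Lemma S2_31 : m != 1%N -> (31 * m)%:R * S2 A (31 * m) = - (m%:R * S2 A m).
Proof.
move=> m_neq1; apply/eqP; rewrite -addr_eq0; apply/eqP/Z2adic_ext => -[|k].
  by rewrite -zres_mod modn1 /= modn1.
have [x x_root] := algint_root_exists.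
rewrite -[LHS]/((zres ((31 * m)%:R * S2 A (31 * m))%R k.+1
  + zres (m%:R * S2 A m)%R k.+1) %% 2 ^ k.+1)%N.
rewrite !zres_dS modnDml modnDmr addnC [RHS]mod0n; apply/eqP.
exact: (dS31_cong algint_2torsion algint_dvd_nat x_root hA).
Qed.

Lemma S2_neq0 : (forall p : nat, (p %| m)%N -> ~~ P0 p) -> S2 A m != 0.
Proof.
move=> m_P0; apply/eqP => S0; have [x x_root] := algint_root_exists.
apply: (dS_nonzero algint_2torsion algint_dvd_nat x_root hA m_odd m_31 m_P0)
  => k.
have := zres_dS A m k; rewrite S0 mulr0 [LHS]mod0n => /esym/eqP/dvdnP[q ->].
by exists q%:R; rewrite mulnC natrM.
Qed.

End Theorem3.

Local Close Scope ring_scope.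

Theorem theorem3 (A : {pred nat}) (hA : npart_congr A P31)
    (m : nat) (m_odd : odd m) (m_neq1 : m != 1) (m_31 : coprime m 31)
    (m_P0 : forall p : nat, p %| m -> ~~ P0 p) :
  [/\ forall k : nat, k < gamma A m ->
        2 ^ k * m \notin A /\ 2 ^ k * (31 * m) \notin A,
      2 ^ gamma A m * m \in A /\ 2 ^ gamma A m * (31 * m) \in A
    & forall r : nat, 1 <= r ->
        (2 ^ (gamma A m + r) * m \in A <->
          exists l : nat, l \in Sr r /\
            z2eqmod r.+1 (m%:R)%R ((l%:R)^-1 * Zunit A m)%R) /\
        (2 ^ (gamma A m + r) * (31 * m) \in A <->
          exists l : nat, l \in Sr r /\
            z2eqmod r.+1 (m%:R)%R (- ((31 * l)%:R)^-1 * Zunit A m)%R)].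
Proof.
have S_neq0 := S2_neq0 hA m_odd m_31 m_P0.
have [SE D_unit] := v2P S_neq0; rewrite -/(gamma A m) in SE D_unit.
move: (divpow2 _ _) SE D_unit => D SE D_unit.
have m_unit := zunit_odd m_odd; have u31 := @zunit_odd 31 isT.
have ZE : Zunit A m = (m%:R * D)%R by rewrite /Zunit SE mulrCA divpow2K.
(* S(31 m) thus has the same valuation as S(m), with unit part - D / 31, and the digits of both are
   read in the same way. *)
have S31E : S2 A (31 * m) = (2%:R ^+ gamma A m * - (31%:R^-1 * D))%R.
  have := S2_31 hA m_odd m_31 m_neq1.
  rewrite SE natrM [(31%:R * _)%R]mulrC -mulrA -mulrN => /(mulrI m_unit) E.
  by rewrite -(mulKr u31 (S2 A (31 * m))) E !mulrN mulrCA.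
have D31_unit : (- (31%:R^-1 * D))%R \is a GRing.unit.
  by rewrite unitrN unitrM unitrV u31.
have [lt1 eq1 gt1] := z2series_digits D_unit SE.
have [lt2 eq2 gt2] := z2series_digits D31_unit S31E.
split=> [k k_lt||r r_gt0]; [by split; [exact: lt1 | exact: lt2] | by split |].
have l_unit l : l \in Sr r -> (l%:R : Z2adic)%R \is a GRing.unit.
  by case/andP=> /zunit_odd.
split; [apply: (iff_trans (gt1 r r_gt0)) | apply: (iff_trans (gt2 r r_gt0))];
  rewrite ZE; split=> -[l [lS lE]]; exists l; (split; first by []).
- exact/(z2eqmod_divl _ _ (l_unit l lS) m_unit).
- exact/(z2eqmod_divl _ _ (l_unit l lS) m_unit).
- by rewrite natrM; apply/(z2eqmod_divlN _ _ (l_unit l lS) m_unit u31).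
- by apply/(z2eqmod_divlN _ _ (l_unit l lS) m_unit u31); rewrite -natrM.
Qed.
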